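(* Let $p$ be an odd prime and let $L/K$ be a separable field extension of degree $p^2$. If $L/K$ has a Hopf Galois structure of type $C_{p^2}$, then it has no Hopf Galois structure of type $C_p\times C_p$. Therefore a separable field extension of degree $p^2$, $p$ an odd prime, has at most one type of Hopf Galois structures, either cyclic ($C_{p^2}$) or elementary abelian ($C_p\times C_p$).
   Context: A Hopf Galois structure on a finite field extension $L/K$ is a pair $(H,\mu)$, where $H$ is a finite cocommutative $K$-Hopf algebra and $\mu: H\to \operatorname{End}_K(L)$ is a $K$-linear map giving $L$ a left $H$-module algebra structure and inducing a $K$-vector space isomorphism $L\otimes_K H\to \operatorname{End}_K(L)$. Hopf Galois structures are considered up to isomorphism (a $K$-Hopf algebra isomorphism compatible with the actions). Let $L/K$ be separable of degree $g$, $\widetilde{L}$ its Galois closure, $G=\mathrm{Gal}(\widetilde{L}/K)$, $G'=\mathrm{Gal}(\widetilde{L}/L)$, and let $\lambda:G\hookrightarrow S_g=\mathrm{Sym}(G/G')$ be given by the action of $G$ on the left cosets $G/G'$. By the Greither–Pareigis theorem, Hopf Galois structures on $L/K$ are in bijection with regular subgroups $N$ of $S_g$ normalized by $\lambda(G)$; the Hopf algebra corresponding to $N$ is $\widetilde{L}[N]^G$, where $G$ acts on $\widetilde{L}$ by $K$-automorphisms and on $N$ by conjugation through $\lambda$. The type of a Hopf Galois structure is the isomorphism class of the corresponding group $N$. $C_n$ denotes the cyclic group of order $n$. *)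

(* Defs.v *)
From HB Require Import structures.
From mathcomp Require Import all_boot all_order all_fingroup all_algebra.
From mathcomp Require Import all_solvable all_field.

Set Implicit Arguments.
Unset Strict Implicit.
Unset Printing Implicit Defensive.

Import GRing.Theory VectorInternalTheory.
Local Open Scope ring_scope.

(* Tensor products of finite-dimensional vector spaces, in coordinates with   *)
(* respect to the bases that v2r fixes on both factors.  tlift B is the       *)
(* linear map on U \ox V induced by a bilinear map B (see tlift_tpure);       *)
(* \tsum_(a \ox b <- t) F is Sweedler's sum of F over a tensor t = "a \ox b". *)
Definition tensor (K : fieldType) (U V : vectType K) : vectType K :=
  'M[K]_(dim U, dim V).

Definition tpure (K : fieldType) (U V : vectType K) (u : U) (v : V) :
  tensor U V := (v2r u)^T *m v2r v.

Definition tlift (K : fieldType) (U V : vectType K) (W : lmodType K)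
    (B : U -> V -> W) (t : tensor U V) : W :=
  \sum_(i < dim U) \sum_(j < dim V)
    (t : 'M[K]_(dim U, dim V)) i j *:
      B (r2v (delta_mx 0 i)) (r2v (delta_mx 0 j)).

Notation "u \ox v" := (tpure u v) (at level 40, v at next level).
Notation "\tsum_ ( a \ox b <- t ) F" := (tlift (fun a b => F) t)
  (at level 41, a at level 0, b at level 0, t at level 60, F at level 41).

Lemma tlift_tpure (K : fieldType) (U V : vectType K) (W : lmodType K)
    (B : U -> V -> W) :
  (forall v, linear (B^~ v)) -> (forall u, linear (B u)) ->
  forall u v, tlift B (u \ox v) = B u v.
Proof.
move=> linl linr u v.
pose Bl w := GRing.isLinear.Build _ _ _ _ (B^~ w) (linl w).
pose Br w := GRing.isLinear.Build _ _ _ _ (B w) (linr w).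
pose fl w : {linear U -> W} := HB.pack (B^~ w) (Bl w).
pose fr w : {linear V -> W} := HB.pack (B w) (Br w).
have expand (V' : vectType K) (w : V') :
    w = \sum_i v2r w 0 i *: r2v (delta_mx 0 i).
  rewrite -[LHS]v2rK {1}[v2r w]row_sum_delta linear_sum /=.
  by apply: eq_bigr => i _; rewrite linearZ.
rewrite [in RHS](expand U u) -[RHS]/(fl v _) linear_sum.
apply: eq_bigr => i _; rewrite linearZ /= {2}(expand V v).
rewrite -[B _ _]/(fr (r2v (delta_mx 0 i)) _) linear_sum scaler_sumr.
apply: eq_bigr => j _; rewrite linearZ /= scalerA; congr (_ *: _).
by rewrite mxE big_ord1 mxE.
Qed.

Record cocommHopfAlg (K : fieldType) := CocommHopfAlg {
  hopf_sort :> falgType K;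
  comul : 'Hom(hopf_sort, tensor hopf_sort hopf_sort);
  counit : 'Hom(hopf_sort, K^o);
  antipode : 'End(hopf_sort);
  comul1 : comul 1 = 1 \ox 1;
  comulM : forall x y, comul (x * y) =
    \tsum_(a \ox b <- comul x) \tsum_(c \ox d <- comul y) (a * c) \ox (b * d);
  counit1 : counit 1 = 1;
  counitM : forall x y, counit (x * y) = (counit x : K) * counit y;
  comulA : forall x,
    \tsum_(a \ox b <- comul x) \tsum_(c \ox d <- comul a) c \ox (d \ox b) =
    \tsum_(a \ox b <- comul x) a \ox comul b;
  counit_l : forall x, \tsum_(a \ox b <- comul x) (counit a : K) *: b = x;
  counit_r : forall x, \tsum_(a \ox b <- comul x) (counit b : K) *: a = x;
  antipode_l : forall x,
    \tsum_(a \ox b <- comul x) antipode a * b = (counit x : K)%:A;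
  antipode_r : forall x,
    \tsum_(a \ox b <- comul x) a * antipode b = (counit x : K)%:A;
  comulC : forall x, \tsum_(a \ox b <- comul x) b \ox a = comul x
}.

Arguments comul {K} _.
Arguments counit {K} _.
Arguments antipode {K} _.

Record hopfGalois (K : fieldType) (L : fieldExtType K) := HopfGalois {
  hg_alg :> cocommHopfAlg K;
  hg_act : 'Hom(hg_alg, 'End(L));
  hg_act1 : forall x, hg_act 1 x = x;
  hg_actM : forall h k x, hg_act (h * k) x = hg_act h (hg_act k x);
  hg_act_unit : forall h, hg_act h 1 = (counit hg_alg h : K)%:A;
  hg_act_mul : forall h x y,
    hg_act h (x * y) =
      \tsum_(a \ox b <- comul hg_alg h) hg_act a x * hg_act b y;
  hg_bij : bijective (fun t : tensor L hg_alg =>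
    \tsum_(x \ox h <- t) (amull x \o hg_act h)%VF)
}.

Definition galoisClosure (K : fieldType) (L : fieldExtType K)
    (E : splittingFieldType K) (iota : 'AHom(L, E)) : Prop :=
  galois 1%AS {:E}%AS /\
  forall M : {subfield E},
    (limg iota <= M)%VS -> galois 1%AS M -> ({:E} <= M)%VS.

(* In MathComp, products of automorphisms and of permutations are read from   *)
(* left to right: (s * t) x = t (s x).  Hence the left cosets s G' of         *)
(* G' = Gal(E/L) for the usual composition s t = s \o t are the right cosets  *)
(* G' :* s here, and G acts on them by right translation.                     *)
Section GreitherPareigis.

Variables (K : fieldType) (L : fieldExtType K) (E : splittingFieldType K).
Variable iota : 'AHom(L, E).

Definition galK : {group gal_of {:E}} := 'Gal({:E} / 1)%G.
Definition galL : {group gal_of {:E}} := 'Gal({:E} / limg iota)%G.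

Definition galCosets : finType :=
  {c : {set gal_of {:E}} | c \in rcosets galL galK}.

Lemma galL_coset : (galL : {set _}) \in rcosets galL galK.
Proof. by apply/rcosetsP; exists 1%g; rewrite ?group1 ?rcoset1. Qed.

Definition baseCoset : galCosets :=
  exist (fun c : {set gal_of {:E}} => c \in rcosets galL galK) _ galL_coset.

Definition lambda (s : gal_of {:E}) : {perm galCosets} :=
  actperm ('Rs^?)%act s.

Lemma val_lambda s c : s \in galK -> val (lambda s c) = (val c :* s)%g.
Proof.
move=> sG; rewrite permE val_subact /= rcosetE ifT //.
rewrite !inE; apply/subsetP => d; rewrite !inE => /rcosetsP[t tG ->].
by apply/rcosetsP; exists (t * s)%g; rewrite ?groupM // /= rcosetE rcosetM.
Qed.

(* The K-embedding x |-> s x of L into E given by the coset of s. *)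
Definition cosetEmb (c : galCosets) (x : L) : E := repr (val c) (iota x).

Definition regular (X : finType) (N : {group {perm X}}) : Prop :=
  [transitive N, on [set: X] | 'P]%g /\ forall x : X, ('C_N[x | 'P] = 1)%g.

(* The group algebra E[N], as the functions n |-> c n that vanish outside N.  *)
(* The usual product of s and t in N is s \o t, that is (t * s)%g.            *)
Definition inGroupAlg (N : {group {perm galCosets}})
    (c : {ffun {perm galCosets} -> E}) : Prop :=
  forall n, n \notin N -> c n = 0.

Definition galFixed (N : {group {perm galCosets}})
    (c : {ffun {perm galCosets} -> E}) : Prop :=
  forall s, s \in galK -> forall n, n \in N -> c (n ^ lambda s)%g = s (c n).

(* phi identifies the Hopf algebra H of S with E[N]^G as a K-Hopf algebra,    *)
(* compatibly with the action of E[N]^G on L, for which \sum_n c_n n sends x  *)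
(* to \sum_n c_n (n^-1 (G'))(x).  The comultiplication of E[N]^G is the       *)
(* restriction of that of E[N], in E[N] \ox_E E[N] = E[N x N].                *)
Definition corresponds (S : hopfGalois L) (N : {group {perm galCosets}}) :
    Prop :=
  exists phi : 'Hom(S, {ffun {perm galCosets} -> E}),
    [/\ injective phi,
        forall c, (exists h, phi h = c) <-> inGroupAlg N c /\ galFixed N c,
        [/\ phi 1 = [ffun n => (n == 1%g)%:R] &
            forall h k, phi (h * k) =
              [ffun n => \sum_s \sum_(t | (t * s)%g == n) phi h s * phi k t]],
        [/\ forall h, (counit S h : K)%:A = \sum_n phi h n,
            forall h,
              \tsum_(a \ox b <- comul S h)
                [ffun mn : {perm galCosets} * {perm galCosets} =>
                   phi a mn.1 * phi b mn.2] =
              [ffun mn => if mn.1 == mn.2 then phi h mn.1 else 0] &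
            forall h, phi (antipode S h) = [ffun n => phi h n^-1%g]] &
        forall h x, iota (hg_act S h x) =
          \sum_n phi h n * cosetEmb ((n^-1)%g baseCoset) x].

Definition hasType (S : hopfGalois L) (gT : finGroupType) (T : {group gT}) :
    Prop :=
  exists N : {group {perm galCosets}},
    [/\ regular N, (lambda @: galK \subset 'N(N))%g,
        corresponds S N & (N \isog T)%g].

End GreitherPareigis.

(* 'Z_n is the integers modulo n for n > 1 only. *)
Definition Cyc (n : nat) : {group 'Z_n} := [set: 'Z_n]%G.
Definition CycSq (n : nat) : {group 'Z_n * 'Z_n} := [set: 'Z_n * 'Z_n]%G.

(* Main.v *)
Require Import Defs.
From mathcomp Require Import all_boot all_order all_fingroup all_algebra.
From mathcomp Require Import all_solvable all_field.

Set Implicit Arguments.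
Unset Strict Implicit.
Unset Printing Implicit Defensive.

Import GroupScope.

(** The statement is about permutation groups.  Let X be the set of the p^2
cosets of G' = Gal(E/L) in G = Gal(E/K): the image A of G is transitive on X and normalises the
regular subgroup N attached to each Hopf Galois structure.  A group of order
p^2 is determined up to isomorphism by whether its exponent divides p, so it
is enough to show that this property passes from one regular subgroup
normalised by A to any other ([exponent_regular_normalised]).

A Sylow p-subgroup Q of A is still transitive, as X has p-power cardinality
([Sylow_atrans]), and it links the two regular subgroups.  The p-group
R = N <*> Q is the product of N and of a point stabiliser S, which acts
faithfully on N by conjugation; this forces |S| to divide p
([card_faithful_p2group]), so |R| divides p^3, R has nilpotency class at most
2 and, p being odd, 'Ohm_1(R) has exponent dividing p.  It contains S.  If
some transitive subgroup H of R has exponent dividing p, then 'Ohm_1(R)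
contains H too, hence S H = R: the whole of R has exponent dividing p
([exponent_atrans_sub]).

With H = N this carries the property from N to Q; with H = Q and the other
regular subgroup M in the role of N, it carries it from Q to M.  For p = 2
this breaks down: in degree 4 the dihedral group of order 8 normalises regular
subgroups of both types, and its 'Ohm_1 has exponent 4. *)

(** * Groups of order p^2 *)

Lemma p2group_exponent_cyclic (gT : finGroupType) (p : nat) (G : {group gT}) :
  prime p -> #|G| = (p ^ 2)%N -> (exponent G %| p) = ~~ cyclic G.
Proof.
move=> p_pr oG; have [cycG | ncycG] := boolP (cyclic G).
  rewrite exponent_cyclic // oG -{2}(expn1 p) dvdn_Pexp2l //.
  exact: prime_gt1.
apply/exponentP=> x Gx; apply/eqP; rewrite -order_dvdn.
have: #[x] %| p ^ 2 by rewrite -oG order_dvdG.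
case/(dvdn_pfactor _ _ p_pr) => [[|[|[|//]]]] _ ox; rewrite ox ?dvd1n //.
case/cyclicP: ncycG; exists x; apply/eqP.
by rewrite eq_sym eqEcard cycle_subG Gx -orderE ox oG /=.
Qed.

Lemma isog_p2group (gT rT : finGroupType) (p : nat)
    (G : {group gT}) (H : {group rT}) :
    prime p -> #|G| = (p ^ 2)%N -> #|H| = (p ^ 2)%N ->
  (G \isog H) = ((exponent G %| p) == (exponent H %| p)).
Proof.
move=> p_pr oG oH; rewrite !(@p2group_exponent_cyclic _ p) //.
have [cycG | ncycG] := boolP (cyclic G).
  by rewrite isog_cyclic_card // oG oH eqxx andbT; case: (cyclic H).
have abelem rT' (M : {group rT'}) :
    #|M| = (p ^ 2)%N -> p.-abelem M = ~~ cyclic M.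
  move=> oM; rewrite abelemE // (card_p2group_abelian p_pr oM).
  exact: p2group_exponent_cyclic.
rewrite (@isog_abelem_card _ _ p) ?abelem // oG oH eqxx andbT.
by case: (cyclic H).
Qed.

(** A p-group S acting on N centralises a nontrivial subgroup of N.  Unless
S = 1, some y in N lies outside 'C_N(S) and generates N together with it, so
that only the identity of S centralises y.  Thus S has as many elements as the
class of y under S, which misses 1 and so has fewer than p^2 elements. *)
Lemma card_faithful_p2group (gT : finGroupType) (p : nat)
    (S N : {group gT}) :
    prime p -> p.-group S -> S \subset 'N(N) -> #|N| = (p ^ 2)%N ->
  'C_S(N) = 1 -> #|S| %| p.
Proof.
move=> p_pr pS nNS oN cSN.
have pN : p.-group N by rewrite /pgroup oN pnatX pnat_id.
have [sNC | ] := boolP (N \subset 'C(S)).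
  by rewrite -(setIidPl (_ : S \subset 'C(N))) 1?centsC // cSN cards1 dvd1n.
case/subsetPn=> y Ny cSy.
have pR : p.-group (N <*> S) by rewrite norm_joinEr // pgroupM pN.
have ntZ : 'C_N(S) != 1.
  have ntN : N :!=: 1.
    by rewrite -cardG_gt1 oN -(expn0 p) ltn_exp2l ?prime_gt1.
  have nsNR : N <| N <*> S by rewrite normalYl.
  apply: contra (meet_center_nil (pgroup_nil pR) nsNR ntN).
  rewrite -!subG1; apply: subset_trans; rewrite setIS //.
  by rewrite subIset // orbC centS ?joing_subr.
have cSy1 : 'C_S[y] = 1.
  (* The centraliser of 'C_S[y] in N contains 'C_N(S) properly, because of y,
     so its order is at least p^2. *)
  apply/trivgP; rewrite -cSN subsetI subsetIl centsC /=.
  have ltC : #|'C_N(S)| < #|'C_N('C_S[y])|.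
    apply: proper_card; rewrite properE setIS ?centS ?subsetIl //=.
    apply/subsetPn; exists y; last by rewrite inE Ny.
    by rewrite inE Ny -sub_cent1 subsetIr.
  suff <- : 'C_N('C_S[y]) = N by apply: subsetIr.
  apply/eqP; rewrite eqEcard subsetIl oN; move: ltC ntZ.
  rewrite -cardG_gt1.
  have /(dvdn_pfactor _ _ p_pr)[i _ ->] : #|'C_N(S)| %| p ^ 2.
    by rewrite -oN cardSg ?subsetIl.
  have /(dvdn_pfactor _ _ p_pr)[j _ ->] : #|'C_N('C_S[y])| %| p ^ 2.
    by rewrite -oN cardSg ?subsetIl.
  have p_gt1 := prime_gt1 p_pr.
  rewrite ltn_exp2l // leq_exp2l //; case: i => // i ltij _.
  exact: leq_trans ltij.
have oS : #|S| = #|y ^: S| by rewrite -index_cent1 cSy1 indexg1.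
have ltS : #|S| < p ^ 2.
  rewrite oS -oN; apply: proper_card; rewrite properE class_sub_norm ?Ny //=.
  apply/subsetPn; exists 1 => //; apply: contra cSy => /imsetP[s _ /eqP].
  by rewrite eq_sym conjg_eq1 => /eqP->; apply: group1.
have [k oSk] := p_natP pS; move: ltS; rewrite oSk => ltS.
by rewrite -{2}(expn1 p) dvdn_exp2l // -ltnS -(ltn_exp2l _ _ (prime_gt1 p_pr)).
Qed.

(** * Transitive and regular permutation groups *)

Lemma card_regular (X : finType) (N : {group {perm X}}) :
  regular N -> #|N| = #|X|.
Proof.
case=> trN regN; have [x _ _] := imsetP trN.
have := card_orbit_stab 'P N x.
by rewrite regN cards1 muln1 (atransP trN) ?inE // cardsT.
Qed.

Lemma stab_cent_atrans (X : finType) (N : {group {perm X}}) (x : X) :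
  [transitive N, on [set: X] | 'P] -> 'C[x | 'P] :&: 'C(N) = 1.
Proof.
move=> trN; apply/trivgP/subsetP => c /setIP[/astab1P /= fixc cNc].
apply/set1P/permP => z; rewrite perm1.
have [n Nn ->] := atransP2 trN (in_setT x) (in_setT z).
by rewrite /= !apermE -!permM -(centP cNc n Nn) permM -!apermE fixc.
Qed.

(** The index of a point stabiliser is a power of p, hence coprime to the index
of Q, so A is the product of the two. *)
Lemma Sylow_atrans (X : finType) (p k : nat) (A Q : {group {perm X}}) :
    prime p -> #|X| = (p ^ k)%N -> [transitive A, on [set: X] | 'P] ->
    p.-Sylow(A) Q ->
  [transitive Q, on [set: X] | 'P].
Proof.
move=> p_pr oX trA sylQ; have [x _ _] := imsetP trA.
apply/(subgroup_transitiveP (in_setT x) (pHall_sub sylQ) trA).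
apply: coprime_index_mulG; rewrite ?subsetIl ?(pHall_sub sylQ) //.
rewrite -card_orbit (atransP trA) ?inE // cardsT oX.
by case/and3P: sylQ => _ _; apply: pnat_coprime; rewrite pnatX pnat_id.
Qed.

(** The group R = N <*> Q is the product of H and a point stabiliser, which both
have exponent dividing p.  As |R| divides p^3, its class is at most 2, so for
odd p the p-th power map kills the subgroup generated by the elements of order
p, and this subgroup is all of R. *)
Lemma exponent_atrans_sub (X : finType) (p : nat) (N Q H : {group {perm X}}) :
    prime p -> odd p -> #|X| = (p ^ 2)%N -> regular N ->
    p.-group Q -> Q \subset 'N(N) ->
    H \subset N <*> Q -> [transitive H, on [set: X] | 'P] ->
  exponent H %| p -> exponent (N <*> Q) %| p.
Proof.
move=> p_pr p_odd oX regN pQ nNQ sHR trH expH.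
have oN : #|N| = (p ^ 2)%N by rewrite card_regular.
have pN : p.-group N by rewrite /pgroup oN pnatX pnat_id.
have [trN regN1] := regN; have [x _ _] := imsetP trN.
set R := N <*> Q in sHR *.
have sNR : N \subset R := joing_subl N Q.
have nNR : R \subset 'N(N) by rewrite join_subG normG.
have pR : p.-group R by rewrite /R norm_joinEr // pgroupM pN.
have trR : [transitive R, on [set: X] | 'P].
  by rewrite (atrans_supgroup sNR trN); apply/actsP => a _ z; rewrite !inE.
pose S := 'C_R[x | 'P].
have defR (M : {group {perm X}}) : M \subset R ->
    [transitive M, on [set: X] | 'P] -> S * M = R.
  by move=> sMR; move/(subgroup_transitiveP (in_setT x) sMR trR).
have pS : p.-group S := pgroupS (subsetIl _ _) pR.
have expS : #|S| %| p.
  apply: (@card_faithful_p2group _ p _ N) => //.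
    by rewrite (subset_trans (subsetIl _ _)).
  by rewrite -setIA stab_cent_atrans // setIg1.
have expO : exponent 'Ohm_1(R) %| p.
  apply: exponent_Ohm1_class2 => //.
  apply: leq_trans (nil_class_pgroup pR) _; rewrite geq_max /=.
  have: #|R| %| p ^ 3.
    by rewrite -(defR N) // (dvdn_trans (dvdn_cardMg _ _)) // oN expnS dvdn_mul.
  case/(dvdn_pfactor _ _ p_pr) => i le_i3 ->.
  by rewrite pfactorK // -subn1 leq_subLR.
have sub_O (M : {group {perm X}}) : M \subset R -> exponent M %| p ->
    M \subset 'Ohm_1(R).
  by move=> sMR expM; rewrite (OhmE 1 pR) sub_gen // subsetI sMR sub_LdivT.
apply: dvdn_trans expO; apply: exponentS.
rewrite -{1}(defR H) // mul_subG //; apply: sub_O => //.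
  exact: subsetIl.
exact: dvdn_trans (exponent_dvdn _) expS.
Qed.

(** The two regular subgroups need not normalise each other; a Sylow p-subgroup
of A serves as intermediary between them. *)
Lemma exponent_regular_normalised (X : finType) (p : nat)
    (A N M : {group {perm X}}) :
    prime p -> odd p -> #|X| = (p ^ 2)%N ->
    [transitive A, on [set: X] | 'P] ->
    regular N -> A \subset 'N(N) -> regular M -> A \subset 'N(M) ->
  exponent N %| p -> exponent M %| p.
Proof.
move=> p_pr p_odd oX trA regN nNA regM nMA expN.
have [Q sylQ] := Sylow_exists p A; have sQA := pHall_sub sylQ.
have trQ := Sylow_atrans p_pr oX trA sylQ; have pQ := pHall_pgroup sylQ.
have expQ : exponent Q %| p.
  apply: dvdn_trans (exponentS (joing_subr N Q)) _.
  apply: (exponent_atrans_sub (H := N)) expN => //; last by case: regN.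
    exact: subset_trans nNA.
  exact: joing_subl.
apply: dvdn_trans (exponentS (joing_subl M Q)) _.
apply: (exponent_atrans_sub (H := Q)) expQ => //; last exact: joing_subr.
exact: subset_trans nMA.
Qed.

(** * The Galois group acting on cosets *)

Section GaloisCosets.

Variables (K : fieldType) (L : fieldExtType K) (E : splittingFieldType K).
Variable iota : 'AHom(L, E).

Lemma card_galCosets : galois 1%AS {:E}%AS -> #|galCosets iota| = \dim {:L}.
Proof.
move=> galE; pose F : {subfield E} := (iota @: {:L})%AS.
have <- : \dim F = \dim {:L}.
  by apply: limg_dim_eq; rewrite (eqP (AHom_lker0 iota)) capv0.
rewrite card_sig -[LHS]/(#|'Gal({:E} / 1) : 'Gal({:E} / F)|).
have sFE : (1 <= F <= {:E})%VS by rewrite sub1v subvf.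
rewrite -divgS ?galS ?sub1v //= -!galois_dim ?(galoisS sFE) //=.
rewrite dimv1 divn1.
have /divnK dE := field_dimS (subvf F).
by rewrite -[X in X %/ _]dE mulKn // divn_gt0 ?adim_gt0 // dimvS ?subvf.
Qed.

Lemma lambda_group_set : group_set (lambda iota @: Defs.galK E).
Proof.
apply/group_setP; split=> [|_ _ /imsetP[s sG ->] /imsetP[t tG ->]].
  apply/imsetP; exists 1; first exact: group1.
  by apply/permP=> c; apply/val_inj; rewrite perm1 val_lambda ?group1 ?rcoset1.
apply/imsetP; exists (s * t); first exact: groupM.
apply/permP=> c; apply/val_inj.
by rewrite permM !val_lambda ?groupM // rcosetM.
Qed.

Lemma lambda_atrans :
  [transitive lambda iota @: Defs.galK E, on [set: galCosets iota] | 'P].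
Proof.
apply/imsetP; exists (baseCoset iota); first by rewrite inE.
apply/setP => c; rewrite inE; apply/esym/orbitP.
have /rcosetsP[s sG defc] := valP c.
exists (lambda iota s); first exact: imset_f.
by apply/val_inj; rewrite /= apermE val_lambda.
Qed.

End GaloisCosets.

(** * The two types of order p^2 *)

Lemma card_Cyc p : prime p -> #|Cyc (p ^ 2)| = (p ^ 2)%N.
Proof.
move=> p_pr.
by rewrite cardsT card_ord Zp_cast // -(exp1n 2) ltn_exp2r ?prime_gt1.
Qed.

Lemma card_CycSq p : prime p -> #|CycSq p| = (p ^ 2)%N.
Proof.
by move=> p_pr; rewrite cardsT card_prod !card_ord Zp_cast ?prime_gt1.
Qed.

Lemma exponent_Cyc p : prime p -> exponent (Cyc (p ^ 2)) %| p = false.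
Proof.
move=> p_pr; rewrite (p2group_exponent_cyclic p_pr (card_Cyc p_pr)).
by apply/negbF/cyclicP; exists Zp1; rewrite -Zp_cycle.
Qed.

Lemma exponent_CycSq p : prime p -> exponent (CycSq p) %| p.
Proof.
move=> p_pr; apply/exponentP => -[a b] _.
have expZ (c : 'Z_p) : c ^+ p = 1.
  have := order_dvdG (in_setT c); rewrite cardsT card_ord Zp_cast ?prime_gt1 //.
  by rewrite order_dvdn => /eqP.
have expX n : (a, b) ^+ n = (a ^+ n, b ^+ n).
  by elim: n => // n IHn; rewrite !expgS IHn.
by rewrite expX !expZ.
Qed.

Theorem proposition7 (p : nat) (p_prime : prime p) (p_odd : odd p)
    (K : fieldType) (L : fieldExtType K)
    (sepL : separable 1%AS {:L}%AS) (dimL : \dim {:L} = (p ^ 2)%N)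
    (E : splittingFieldType K) (iota : 'AHom(L, E))
    (closE : galoisClosure iota) :
  ((exists S : hopfGalois L, hasType iota S (Cyc (p ^ 2))) ->
     ~ exists S : hopfGalois L, hasType iota S (CycSq p)) /\
  (forall (S1 S2 : hopfGalois L) (gT1 gT2 : finGroupType)
          (T1 : {group gT1}) (T2 : {group gT2}),
     hasType iota S1 T1 -> hasType iota S2 T2 ->
     (T1 \isog T2)%g /\ ((T1 \isog Cyc (p ^ 2))%g \/ (T1 \isog CycSq p)%g)).
Proof.
have [galE _] := closE; have oX := card_galCosets iota galE.
rewrite dimL in oX.
have card_type S gT (T : {group gT}) : hasType iota S T -> #|T| = (p ^ 2)%N.
  by case=> N [regN _ _ /card_isog <-]; rewrite card_regular.
have exp_type S1 S2 gT1 gT2 (T1 : {group gT1}) (T2 : {group gT2}) :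
    hasType iota S1 T1 -> hasType iota S2 T2 ->
  exponent T1 %| p -> exponent T2 %| p.
  case=> N [regN nNA _ /exponent_isog <-] [M [regM nMA _ /exponent_isog <-]].
  exact: (exponent_regular_normalised (A := Group (lambda_group_set iota)))
    p_prime p_odd oX (lambda_atrans iota) regN nNA regM nMA.
split=> [[S1 typ1] [S2 typ2] | S1 S2 gT1 gT2 T1 T2 typ1 typ2].
  have := exp_type _ _ _ _ _ _ typ2 typ1 (exponent_CycSq p_prime).
  by rewrite exponent_Cyc.
have o1 := card_type _ _ _ typ1; have o2 := card_type _ _ _ typ2.
split; first rewrite (isog_p2group p_prime o1 o2).
  by apply/eqP; apply/idP/idP;
    [exact: exp_type typ1 typ2 | exact: exp_type typ2 typ1].
have [eT1 | nT1] := boolP (exponent T1 %| p); [right | left].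
  by rewrite (isog_p2group p_prime o1 (card_CycSq p_prime)) eT1 exponent_CycSq.
by rewrite (isog_p2group p_prime o1 (card_Cyc p_prime)) (negPf nT1) exponent_Cyc.
Qed.
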